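(* Let $m$ be a positive integer and let $e_0,\dots,e_{2m-1}\subseteq\mathbb Z/2m\mathbb Z$ be a central antipodal-free Hamiltonian label system that has no free-label two-gap Berge cycle of length $m+1$. For $1\le k\le m-2$ write $\bar k=m-1-k$, and let $\rho_p(k)\in\{+,-,0\}$ denote the spin of row $p$ in column $k$. (i) If $m$ is even, there are signs $\sigma_k\in\{+,-\}$ for $1\le k\le m-2$ with $\sigma_{\bar k}=-\sigma_k$ for all $k$, such that for all $p\in\mathbb Z/2m\mathbb Z$ and all $1\le k\le m-2$, $\rho_p(k)\ne 0$ implies $\rho_p(k)=\sigma_k$. (ii) If $m=2h+1$ is odd, the same conclusion holds on the noncentral columns: there are signs $\sigma_k\in\{+,-\}$ for $1\le k\le m-2$, $k\ne h$, with $\sigma_{\bar k}=-\sigma_k$, such that for all $p$ and all $k\ne h$, $\rho_p(k)\neq 0$ implies $\rho_p(k)=\sigma_k$ (with no exceptional noncentral cell). The central column $h$ is unrestricted.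
   Context: All indices $p$ and vertices are elements of $\mathbb Z/2m\mathbb Z$. For $a,b\in\mathbb Z/2m\mathbb Z$, $[a,b]^+$ denotes the clockwise interval $\{a,a+1,\dots,b\}$ (both endpoints included). An antipodal pair is a set $\{x,x+m\}$. A central antipodal-free Hamiltonian label system is a collection of distinct $(m-1)$-element sets $e_0,\dots,e_{2m-1}\subseteq\mathbb Z/2m\mathbb Z$ such that $\{p,p+1\}\subseteq e_p$ for every $p$ and no $e_p$ contains an antipodal pair. Spins: for $p\in\mathbb Z/2m\mathbb Z$ and $1\le k\le m-2$, $\rho_p(k)=+$ if $p-k\in e_p$; $\rho_p(k)=-$ if $p-k+m\in e_p$; and $\rho_p(k)=0$ if neither $p-k$ nor $p-k+m$ lies in $e_p$. Here $p$ is the row and $k$ the column. On signs, $-\sigma$ denotes the opposite sign. Free-label two-gap Berge cycle: the system has a free-label two-gap Berge cycle of length $m+1$ if there exist integers $1\le d,e\le 2m-1$ with $d+e=m+1$, two disjoint cyclic intervals $I=[x,x+d-1]^+$ and $J=[y,y+e-1]^+$ in $\mathbb Z/2m\mathbb Z$ (so $|I|=d$, $|J|=e$), and two distinct indices $i,j\in I\cup J$ such that $\{x,x+d\}\subseteq e_i$ and $\{y,y+e\}\subseteq e_j$. (In general such a configuration yields a Berge cycle of length $2m-d-e+2$.) In (ii), $h=(m-1)/2$ is the unique column with $\bar h=h$, called the central column; for $m$ even no column satisfies $\bar k=k$. *)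

(* Defs.v *)
From mathcomp Require Import all_boot all_algebra.

Set Implicit Arguments.
Unset Strict Implicit.
Unset Printing Implicit Defensive.

Import GRing.Theory.
Local Open Scope ring_scope.

(* Z/2mZ is 'Z_(2 * m), which has exactly 2m elements as soon as 0 < m. *)

(* [a, b]^+ = {a, a + 1, ..., b}; the coercion to nat sends b - a to its
   representative in [0, 2m), so the interval has between 1 and 2m elements. *)
Definition cyc_interval (m : nat) (a b : 'Z_(2 * m)) : {set 'Z_(2 * m)} :=
  [set a + t%:R | t : 'I_(2 * m) & (t <= (b - a)%R)%N].

Record central_label_system (m : nat)
    (e : 'Z_(2 * m) -> {set 'Z_(2 * m)}) : Prop := CentralLabelSystem {
  label_inj : injective e;
  label_card : forall p, #|e p| = (m - 1)%N;
  label_edge : forall p, [set p; p + 1] \subset e p;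
  label_antipodal_free :
    forall p x, ~~ ([set x; x + m%:R] \subset e p)
}.

Inductive sign := Plus | Minus.

Definition opp_sign (s : sign) : sign :=
  match s with Plus => Minus | Minus => Plus end.

(* The spin rho_p(k), with None for the spin 0. For an antipodal-free e the
   first two cases exclude each other, so their order is immaterial. *)
Definition spin (m : nat) (e : 'Z_(2 * m) -> {set 'Z_(2 * m)})
    (p : 'Z_(2 * m)) (k : nat) : option sign :=
  if p - k%:R \in e p then Some Plus
  else if p - k%:R + m%:R \in e p then Some Minus
  else None.

(* d and f are the two gap lengths; e is reserved for the labels. *)
Definition free_label_two_gap_cycle (m : nat)
    (e : 'Z_(2 * m) -> {set 'Z_(2 * m)}) : Prop :=
  exists (d f : nat) (x y i j : 'Z_(2 * m)),
    let I := cyc_interval x (x + d%:R - 1) in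
    let J := cyc_interval y (y + f%:R - 1) in
    [/\ (1 <= d <= 2 * m - 1)%N, (1 <= f <= 2 * m - 1)%N & (d + f = m + 1)%N]
    /\ [disjoint I & J]
    /\ [/\ i \in I :|: J, j \in I :|: J & i != j]
    /\ [set x; x + d%:R] \subset e i
    /\ [set y; y + f%:R] \subset e j.

Definition column (m k : nat) : bool := (1 <= k <= m - 2)%N.

Definition bar (m k : nat) : nat := (m - 1 - k)%N.

(* Main.v *)
(** Antipodal-freeness and the cardinality m - 1 leave exactly one zero spin in
    each row.  Two chords with labels at the ends of the gaps show, in the
    absence of a two-gap cycle:
    (A) spin - in (p, k) excludes spin + in (p + n, k) for m <= n <= 2m - 1;
    (B) spin s in (p, k) excludes spin s in (p + n, bar k) for
        m - k <= n <= 2m - k - 1.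
    If column k has a - in row p and a + in row p + s, then s < m by (A), and in
    row p - (k + 1) column bar k is zero by (B) twice.  So column k is nonzero
    there, and equal to - by (A); this replaces s by s + k + 1, which cannot go
    on for ever.  If columns k and bar k carry the same sign, then (B) puts
    zeros of bar k on a half circle, hence forces column k to be nonzero there;
    applying (B) to all these rows makes column bar k vanish entirely. *)
Require Import Defs.
From mathcomp Require Import all_boot all_algebra.
From mathcomp Require Import ring zify.

Set Implicit Arguments.
Unset Strict Implicit.
Unset Printing Implicit Defensive.

Import GRing.Theory.

(** * Offsets and intervals in Z/2mZ *)

Section CyclicGroup.

Local Open Scope ring_scope.

Variables (m : nat) (m_gt0 : (0 < m)%N).
Implicit Types x y p q : 'Z_(2 * m).

Let m2_gt1 : (1 < 2 * m)%N. Proof. lia. Qed.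

Lemma natr_Z2m_eq (a b : nat) :
  (a%:R == b%:R :> 'Z_(2 * m)) = (a == b %[mod 2 * m]).
Proof. by rewrite -val_eqE /= !val_Zp_nat. Qed.

Lemma natr_Z2m : (2 * m)%:R = 0 :> 'Z_(2 * m).
Proof. by apply/eqP; rewrite -[0]/(0%:R) natr_Z2m_eq modnn mod0n. Qed.

Lemma Z2m_offset p q : exists2 n, (n < 2 * m)%N & q = p + n%:R.
Proof.
exists (val (q - p)); last by rewrite natr_Zp; ring.
by have := ltn_ord (q - p); rewrite {2}Zp_cast.
Qed.

Lemma mem_cyc_interval x (d t : nat) : (t < d)%N -> (d <= 2 * m)%N ->
  x + t%:R \in cyc_interval x (x + d%:R - 1).
Proof.
move=> ltd led; have lt2 : (t < 2 * m)%N by lia.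
apply/imsetP; exists (Ordinal lt2) => //; rewrite inE.
have -> : x + d%:R - 1 - x = d.-1%:R :> 'Z_(2 * m).
  by rewrite -subn1 natrB; [ring | lia].
by rewrite val_Zp_nat // modn_small /=; lia.
Qed.

Lemma cyc_intervalP x (d : nat) y : (0 < d <= 2 * m)%N ->
  y \in cyc_interval x (x + d%:R - 1) -> exists2 t, (t < d)%N & y = x + t%:R.
Proof.
move=> hd /imsetP[t]; rewrite inE.
have -> : x + d%:R - 1 - x = d.-1%:R :> 'Z_(2 * m).
  by rewrite -subn1 natrB; [ring | lia].
rewrite val_Zp_nat // modn_small; last lia.
by move=> le_td ->; exists t => //; lia.
Qed.

Lemma disjoint_cyc_interval x (d c f : nat) :
    (0 < d <= c)%N -> (0 < f)%N -> (c + f <= 2 * m)%N ->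
  [disjoint cyc_interval x (x + d%:R - 1)
          & cyc_interval (x + c%:R) (x + c%:R + f%:R - 1)].
Proof.
move=> hd hf hcf; apply/pred0P => z /=; apply/negP => /andP[].
move=> /cyc_intervalP[|t lt_td ->]; first lia.
move=> /cyc_intervalP[|u lt_uf]; first lia.
rewrite -addrA => /addrI /eqP.
by rewrite -natrD natr_Z2m_eq !modn_small; lia.
Qed.

Lemma oppr_half : - m%:R = m%:R :> 'Z_(2 * m).
Proof.
by apply/eqP; rewrite eq_sym -addr_eq0 -natrD addnn -mul2n natr_Z2m.
Qed.

Lemma Z2m_eq_mod_half x y : val x = val y %[mod m] -> x = y \/ x = y + m%:R.
Proof.
move=> exy.
have lt_x : (val x < 2 * m)%N by have := ltn_ord x; rewrite {2}Zp_cast.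
have lt_y : (val y < 2 * m)%N by have := ltn_ord y; rewrite {2}Zp_cast.
have : val x = val y \/ val x = (val y + m)%N \/ val y = (val x + m)%N.
  have := divn_eq (val x) m; have := divn_eq (val y) m; rewrite exy.
  have : (val x %/ m < 2)%N by rewrite ltn_divLR.
  have : (val y %/ m < 2)%N by rewrite ltn_divLR.
  by case: (val x %/ m)%N => [|[|//]]; case: (val y %/ m)%N => [|[|//]] _ _; lia.
case=> [/val_inj|[E|E]]; first by left.
- by right; rewrite -[x]natr_Zp -[y]natr_Zp -natrD -E.
- right; have -> : y = x + m%:R by rewrite -[x]natr_Zp -[y]natr_Zp -natrD -E.
  by rewrite -{1}oppr_half addrNK.
Qed.

End CyclicGroup.

(** * Spins of a label system and the obstructions (A) and (B) *)

Section Labels.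

Local Open Scope ring_scope.

Variables (m : nat) (e : 'Z_(2 * m) -> {set 'Z_(2 * m)}).
Hypothesis m_gt0 : (0 < m)%N.
Hypothesis he : central_label_system e.
Hypothesis hfree : ~ free_label_two_gap_cycle e.
Implicit Types p q x : 'Z_(2 * m).

(** One membership test per sign, without the priority built into [spin]; antipodal-freeness makes
    the two agree. *)
Definition has_spin (p : 'Z_(2 * m)) (k : nat) (s : sign) : bool :=
  p - k%:R + (if s is Minus then m%:R else 0) \in e p.

Lemma has_spin_opp p k s : has_spin p k s -> ~~ has_spin p k (opp_sign s).
Proof.
have := label_antipodal_free he p (p - k%:R).
rewrite subUset !sub1set /has_spin negb_and.
by case: s => /=; rewrite addr0; case: (p - k%:R \in e p) => //= /negPf ->.
Qed.

Lemma spinP p k s : spin e p k = Some s <-> has_spin p k s.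
Proof.
have := @has_spin_opp p k Plus; rewrite /spin /has_spin /= addr0.
by case: s; rewrite ?addr0; case: (p - k%:R \in e p);
  case: (p - k%:R + m%:R \in e p) => // /(_ isT).
Qed.

(* Sending x to p - x modulo m is injective on an antipodal-free set and misses
   the columns in which row p has spin zero. *)
Lemma one_zero p k l : column m k -> column m l -> k <> l ->
  exists s, has_spin p k s \/ has_spin p l s.
Proof.
rewrite /column => hk hl neq_kl.
pose f x : 'I_m := Ordinal (ltn_pmod (val (p - x)) m_gt0).
have antip x : x \in e p -> x + m%:R \notin e p.
  by have := label_antipodal_free he p x; rewrite subUset !sub1set negb_and;
    case: (x \in e p).
have f_inj : {in e p &, injective f}.
  move=> x y xe ye /(congr1 val) /(Z2m_eq_mod_half m_gt0).
  case=> [/addrI /oppr_inj //|E].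
  have Ey : y = x + m%:R.
    by rewrite -(subKr p y) (_ : p - y = p - x - m%:R); [ring | rewrite E addrK].
  by have := antip x xe; rewrite -Ey ye.
have f_spin x n : column m n -> x \in e p -> f x = n :> nat ->
    exists s, has_spin p n s.
  rewrite /column => hn xe fx.
  have [] := @Z2m_eq_mod_half m m_gt0 (p - x) n%:R.
  - have -> : val (n%:R : 'Z_(2 * m)) = n.
      by rewrite /= val_Zp_nat ?modn_small; lia.
    by rewrite [RHS]modn_small; [exact: fx | lia].
  - by move=> E; exists Plus; rewrite /has_spin addr0 -E subKr.
  - move=> E; exists Minus; rewrite /has_spin.
    by have -> : p - n%:R + m%:R = x by rewrite -(subKr p x) E opprD oppr_half // addrA.
have [s|none] := pickP [pred x in e p | (f x == k :> nat) || (f x == l :> nat)].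
  case/andP=> se /orP[] /eqP /(f_spin _ _ _ se) [] // t ht; exists t; tauto.
have ltk : (k < m)%N by lia.
have ltl : (l < m)%N by lia.
(* Otherwise m - 1 distinct residues modulo m would avoid both k and l. *)
have : f @: e p \subset ~: [set Ordinal ltk; Ordinal ltl].
  apply/subsetP => _ /imsetP[x xe ->]; have := none x; rewrite !inE xe /=.
  by rewrite -!val_eqE /= => ->.
move/subset_leq_card; rewrite (card_in_imset f_inj) (label_card he).
have := cardsC [set Ordinal ltk; Ordinal ltl].
rewrite cards2 -val_eqE /= card_ord; case: eqP => // _; lia.
Qed.

(** Normal form of the forbidden cycle: the gaps start at offsets 0 and [c] from [x], so [d <= c]
    and [c + f <= 2 * m] keep them disjoint, which also makes the two labels distinct. *)
Lemma gap_pair x (d c f s t : nat) : (s < d <= c)%N -> (t < f)%N ->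
    (c + f <= 2 * m)%N -> (d + f = m + 1)%N ->
    x \in e (x + s%:R) -> x + d%:R \in e (x + s%:R) ->
    x + c%:R \in e (x + c%:R + t%:R) ->
    x + c%:R + f%:R \in e (x + c%:R + t%:R) ->
  False.
Proof.
move=> hd hf hcf dfm i1 i2 j1 j2; apply: hfree.
have dis : [disjoint cyc_interval x (x + d%:R - 1)
          & cyc_interval (x + c%:R) (x + c%:R + f%:R - 1)].
  by apply: disjoint_cyc_interval; lia.
have iI : x + s%:R \in cyc_interval x (x + d%:R - 1).
  by apply: mem_cyc_interval; lia.
have jJ : x + c%:R + t%:R \in cyc_interval (x + c%:R) (x + c%:R + f%:R - 1).
  by apply: mem_cyc_interval; lia.
exists d, f, x, (x + c%:R), (x + s%:R), (x + c%:R + t%:R) => /=.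
split; first by split; lia.
split; first exact: dis.
split; first by rewrite !inE iI jJ orbT; split=> //; apply/eqP => E;
  move: (disjointFr dis iI); rewrite E jJ.
by rewrite !subUset !sub1set i1 i2 j1 j2.
Qed.

Lemma mem_label p : p \in e p.
Proof. by have := label_edge he p; rewrite subUset !sub1set => /andP[]. Qed.

Lemma mem_label_succ p : p + 1 \in e p.
Proof. by have := label_edge he p; rewrite subUset !sub1set => /andP[]. Qed.

Lemma has_spin_minusE p k : (k <= m)%N ->
  has_spin p k Minus = (p + (m - k)%:R \in e p).
Proof. by move=> lekm; rewrite /has_spin natrB // addrA addrAC. Qed.

(** This is (A). With q = p + n, the chords are {p, p + m - k} in e_p and {q - k, q + 1} in e_q.
    Their lengths add up to m + 1, and the bounds on [n] say that the gaps are disjoint. *)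
Lemma opposite_spin_column p k (n : nat) : column m k ->
  (m <= n < 2 * m)%N -> has_spin p k Minus -> ~~ has_spin (p + n%:R) k Plus.
Proof.
rewrite /column => hk hn; rewrite has_spin_minusE; last lia.
rewrite /has_spin addr0 => hp; apply/negP => hq.
have E : p + n%:R = p + (n - k)%:R + k%:R by rewrite -addrA -natrD subnK //; lia.
apply: (@gap_pair p (m - k) (n - k) k.+1 0 k) => //; try lia.
- by rewrite addr0 mem_label.
- by rewrite addr0.
- by rewrite -E natrB ?addrA //; lia.
- by rewrite -natr1 addrA -E mem_label_succ.
Qed.

(** This is (B). With q = p + n, spin + gives chords of lengths k + 1 and m - k ending at p + 1 and
    q + 1; spin - gives chords of lengths m - k and k + 1 starting at p and q. *)
Lemma same_spin_bar p k (n : nat) s : column m k ->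
    (m - k <= n <= 2 * m - k - 1)%N -> has_spin p k s ->
  ~~ has_spin (p + n%:R) (bar m k) s.
Proof.
rewrite /column /bar => hk hn; case: s.
- rewrite /has_spin !addr0 => hp; apply/negP => hq.
  (* The distance from p - k to q - bar k, where the two chords start. *)
  pose c := (n + 2 * k + 1 - m)%N.
  have Ep : p = p - k%:R + k%:R by rewrite subrK.
  have Eq : p + n%:R = p - k%:R + c%:R + (m - 1 - k)%:R.
    rewrite -addrA -natrD (_ : (c + _)%N = (n + k)%N); last by rewrite /c; lia.
    by rewrite natrD addrCA subrK addrC.
  apply: (@gap_pair (p - k%:R) k.+1 c (m - k) k (m - 1 - k)); rewrite ?/c; try lia.
  + by rewrite -Ep.
  + by rewrite -Ep -natr1 addrA -Ep mem_label_succ.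
  + by rewrite -/c -Eq; move: hq; rewrite Eq addrK.
  + rewrite -/c (_ : (m - k)%N = (m - 1 - k).+1); last lia.
    by rewrite -natr1 addrA -Eq mem_label_succ.
- rewrite !has_spin_minusE; try lia.
  rewrite (_ : (m - (m - 1 - k))%N = k.+1); last lia.
  move=> hp; apply/negP => hq.
  apply: (@gap_pair p (m - k) n k.+1 0 0) => //; try lia;
  by rewrite ?addr0 ?mem_label.
Qed.

Lemma column_bar k : column m k -> column m (bar m k).
Proof. by rewrite /column /bar; lia. Qed.

Lemma barK k : column m k -> bar m (bar m k) = k.
Proof. by rewrite /column /bar; lia. Qed.

(** * A noncentral column carries at most one sign *)

Section NoncentralColumn.

Variable k : nat.
Hypotheses (hk : column m k) (nc : bar m k <> k).

Lemma constant_column p q : has_spin p k Minus -> has_spin q k Plus -> False.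
Proof.
move=> hp hq; have [s lt_s2 Eq] := Z2m_offset m_gt0 p q.
rewrite {}Eq in hq.
have [N leN] := ubnP (m - s); elim: N => // N IH in s p leN lt_s2 hp hq *.
have lt_sm : (s < m)%N.
  by rewrite ltnNge; apply/negP => le_ms; move: hq; apply/negP;
    apply: opposite_spin_column; rewrite ?le_ms.
have s_gt0 : (0 < s)%N.
  by rewrite lt0n; apply: contraTneq hq => ->; rewrite addr0; exact: (has_spin_opp hp).
(* [n] represents -(k + 1): the largest offset allowed in (B), and at least m as (A) requires. Seen
   from p + s, row [j] is at offset n - s, which (B) allows because s < m. *)
pose n := (2 * m - k - 1)%N; pose j := p + n%:R.
have := hk; rewrite /column => hk'.
have ej : p + s%:R = j + (s + k.+1)%:R.
  rewrite /j -addrA -natrD (_ : (n + _)%N = (s + 2 * m)%N); last by rewrite /n; lia.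
  by rewrite natrD natr_Z2m // addr0.
have [t []] := one_zero j hk (column_bar hk) (nesym nc).
- case: t => [|hj].
    by apply/negP; apply: opposite_spin_column => //; rewrite /n; lia.
  by apply: (IH (s + k.+1)%N j) => //; rewrite -?ej //; lia.
- case: t; apply/negP.
    have -> : j = p + s%:R + (n - s)%:R.
      by rewrite /j -addrA -natrD subnKC // /n; lia.
    by apply: same_spin_bar => //; rewrite /n; lia.
  by apply: same_spin_bar => //; rewrite /n; lia.
Qed.

Lemma constant_column_sign p q s t : has_spin p k s -> has_spin q k t -> s = t.
Proof.
case: s; case: t => // hp hq; first by case: (constant_column hq hp).
by case: (constant_column hp hq).
Qed.

End NoncentralColumn.

(** * Columns k and bar k never share a sign *)

Section NoncentralPair.

Variable k : nat.
Hypotheses (hk : column m k) (nc : bar m k <> k).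

Lemma opposite_columns p q s :
  has_spin p k s -> has_spin q (bar m k) s -> False.
Proof.
move=> hp hq.
have ncb : bar m (bar m k) <> bar m k by rewrite barK //; exact: nesym.
(* (B) forbids [s] in column bar k at row r + n, and [hq] makes [s] the only sign of that column;
   its spin there is zero, so column k is nonzero. *)
have same n r : has_spin r k s -> (m - k <= n <= 2 * m - k - 1)%N ->
    has_spin (r + n%:R) k s.
  move=> hr hn; have [t []] := one_zero (r + n%:R) hk (column_bar hk) (nesym nc).
    by move=> ht; rewrite (constant_column_sign hk nc hr ht).
  move=> ht; have es := constant_column_sign (column_bar hk) ncb hq ht.
  by case/negP: (same_spin_bar hk hn hr); rewrite es.
have := hk; rewrite /column => hk'.
have [n lt_n Eq] := Z2m_offset m_gt0 p q.
rewrite {}Eq in hq.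
have [in1|out1] := boolP (m - k <= n <= 2 * m - k - 1)%N.
  by case/negP: (same_spin_bar hk in1 hp).
(* The half circles p + a + [m - k, 2m - k - 1], for a in the same range, cover
   everything outside p + [m - k, 2m - k - 1]; N is the representative of n
   modulo 2m that is such a sum a + b. *)
have [N lt_N EN] : exists2 N, (2 * m - 2 * k <= N <= 4 * m - 2 * k - 2)%N &
    n%:R = N%:R :> 'Z_(2 * m).
  have [le_n|lt_nm] := leqP (2 * m - 2 * k) n; first by exists n => //; lia.
  by exists (n + 2 * m)%N; [lia | rewrite natrD natr_Z2m // addr0].
(* By truncated subtraction a = m - k as long as N - a stays in range; beyond that, N - a is kept at
   its maximum 2m - k - 1. *)
pose a := (m - k + (N - (3 * m - 2 * k - 1)))%N.
have ha : (m - k <= a <= 2 * m - k - 1)%N by rewrite /a; lia.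
have hb : (m - k <= N - a <= 2 * m - k - 1)%N by rewrite /a; lia.
have := same_spin_bar hk hb (same a p hp ha).
by rewrite -addrA -natrD subnKC -?EN ?hq //; lia.
Qed.

End NoncentralPair.

Lemma noncentral_signs : exists sigma : nat -> sign,
  (forall k, column m k -> bar m k <> k -> sigma (bar m k) = opp_sign (sigma k)) /\
  (forall p k, column m k -> bar m k <> k ->
     spin e p k <> None -> spin e p k = Some (sigma k)).
Proof.
(* Both columns of the pair are consulted, so that an identically zero column still gets the sign
   dictated by its partner. *)
pose evidence k := [exists p, has_spin p k Plus || has_spin p (bar m k) Minus].
exists (fun k => if evidence k then Plus else Minus).
have spin_sign p k s : column m k -> bar m k <> k -> has_spin p k s ->
    evidence k = if s is Plus then true else false.
  move=> hk nc hp; apply/existsP; case: s hp => hp; first by exists p; rewrite hp.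
  case=> q /orP[hq|]; first exact: constant_column hp hq.
  exact: opposite_columns hp.
have spin_bar_sign p k s : column m k -> bar m k <> k -> has_spin p (bar m k) s ->
    evidence k = if s is Plus then false else true.
  move=> hk nc hp; apply/existsP; case: s hp => hp; last first.
    by exists p; rewrite hp orbT.
  case=> q /orP[hq|hq]; first exact: opposite_columns hq hp.
  apply: constant_column hq hp; first exact: column_bar.
  by rewrite barK //; exact: nesym.
split=> [k hk nc | p k hk nc].
  have hb := column_bar hk.
  have ncb : bar m (bar m k) <> bar m k by rewrite barK //; exact: nesym.
  (* Any row would do: one nonzero spin in either column fixes both signs. *)
  have [s [] hs] := one_zero 0 hk hb (nesym nc).
    rewrite (spin_sign _ _ _ hk nc hs) (spin_bar_sign 0 _ s hb ncb) ?barK //.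
    by case: s {hs}.
  by rewrite (spin_bar_sign _ _ _ hk nc hs) (spin_sign _ _ _ hb ncb hs); case: s {hs}.
case E: (spin e p k) => [s|//] _.
by move/spinP: E => /(spin_sign _ _ _ hk nc) ->; case: s.
Qed.

End Labels.

Theorem theorem6p7 (m : nat) (hm : 0 < m)
    (e : 'Z_(2 * m) -> {set 'Z_(2 * m)})
    (he : central_label_system e)
    (hfree : ~ free_label_two_gap_cycle e) :
  (~~ odd m ->
     exists sigma : nat -> sign,
       (forall k, column m k -> sigma (bar m k) = opp_sign (sigma k)) /\
       (forall (p : 'Z_(2 * m)) k, column m k ->
          spin e p k <> None -> spin e p k = Some (sigma k)))
  /\
  (forall h : nat, m = 2 * h + 1 ->
     exists sigma : nat -> sign,
       (forall k, column m k -> k <> h ->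
          sigma (bar m k) = opp_sign (sigma k)) /\
       (forall (p : 'Z_(2 * m)) k, column m k -> k <> h ->
          spin e p k <> None -> spin e p k = Some (sigma k))).
Proof.
have [sigma [sigma_bar sigma_spin]] := noncentral_signs hm he hfree.
split=> [even_m | h mE]; exists sigma.
  have nc k : column m k -> bar m k <> k by rewrite /column /bar; lia.
  by split=> [k hk | p k hk]; [apply: sigma_bar | apply: sigma_spin] => //; exact: nc.
have nc k : column m k -> k <> h -> bar m k <> k by rewrite /column /bar; lia.
by split=> [k hk kh | p k hk kh]; [apply: sigma_bar | apply: sigma_spin] => //; exact: nc.
Qed.
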